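(* Let $\Gamma^{2,2}=\{(k,l;m,n)\mid k,l,m,n\in\mathbb{Z}\}$ be the rank-4 lattice with the symmetric bilinear form determined by $|(k,l;m,n)|^2=-2kl-2mn$, and let $\Delta^{latt}=\{\alpha\in\Gamma^{2,2}\mid \alpha^2=2\}$. Let $h:\Gamma^{2,2}\to\mathbb{R}$ be a group homomorphism (into the additive group of $\mathbb{R}$) such that $h(\alpha)\neq 0$ for all $\alpha\in\Delta^{latt}$. Then $0$ is an accumulation point of the image of $h$.
   Context: The lattice $\Gamma^{2,2}={\rm II}_{1,1}\oplus{\rm II}_{1,1}$ is the even, self-dual lattice of signature $(2,2)$. In the coordinates used here its bilinear form is $((k,l;m,n),(k',l';m',n'))=-kl'-k'l-mn'-m'n$, and $\alpha^2=|\alpha|^2=(\alpha,\alpha)$. The elements of $\Delta^{latt}$ are called lattice roots; they are the integral solutions of $kl+mn=-1$. *)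

(* Defs.v *)
From HB Require Import structures.
From mathcomp Require Import all_boot all_order all_algebra.
From mathcomp Require Import all_classical all_reals all_analysis.
From mathcomp Require Import ring.
Import numFieldNormedType.Exports.

Set Implicit Arguments.
Unset Strict Implicit.
Unset Printing Implicit Defensive.

Import Order.TTheory GRing.Theory Num.Theory.
Local Open Scope ring_scope.
Local Open Scope classical_set_scope.

(* (k, l; m, n) is encoded as ((k, l), (m, n)), one pair per hyperbolic plane
   II_{1,1}; the group structure is the componentwise one. A notation, so that
   the zmodType instance on products is found. *)
Notation Gamma22 := ((int * int) * (int * int))%type.

Definition form22 (x y : Gamma22) : int :=
  - (x.1.1 * y.1.2) - y.1.1 * x.1.2 - x.2.1 * y.2.2 - y.2.1 * x.2.2.

Lemma form22_sqr (k l m n : int) :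
  form22 ((k, l), (m, n)) ((k, l), (m, n)) = - 2 * k * l - 2 * m * n.
Proof. by rewrite /form22 /=; ring. Qed.

Definition lattice_roots : set Gamma22 := [set a | form22 a a = 2].

(* Main.v *)
Require Import Defs.
From HB Require Import structures.
From mathcomp Require Import all_boot all_order all_algebra.
From mathcomp Require Import all_classical all_reals all_analysis.
From mathcomp Require Import ring lra.
Import numFieldNormedType.Exports.

(** If [0] is not an accumulation point of the image of [h], the image is a
discrete subgroup of the reals, hence infinite cyclic or trivial: [h] is a real
number [g] times a homomorphism to the integers
([discrete_image_cyclic]), say
[(k, l; m, n) |-> k * A + l * B + m * C + n * D]. It then suffices to find, for
any integers [A], [B], [C], [D], a lattice root on which this integral form
vanishes ([exists_orthogonal_root]), since such a root contradicts the
hypothesis on [h].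

To find it, identify the lattice with the integral 2 x 2 matrices, [(k, l; m, n)]
corresponding to [M] with rows [(k, m)] and [(- n, l)]. Then
[\det M = k * l + m * n], so roots are the matrices of determinant [-1], and any
integral linear form is [M |-> \tr (N *m M)] for some integral [N]. Multiplying
by unimodular matrices on both sides brings [N] to diagonal form (Smith), and the
trace against a diagonal matrix vanishes on every antidiagonal matrix, in
particular on one of the required determinant
([exists_traceless_product]). In lattice terms: every vector is moved by the
orthogonal group into the first hyperbolic plane, and the second one contains
roots. *)

Set Implicit Arguments.
Unset Strict Implicit.
Unset Printing Implicit Defensive.

Import Order.TTheory GRing.Theory Num.Theory.
Local Open Scope ring_scope.
Local Open Scope classical_set_scope.

Lemma nonzero_image_bounded_below (R : realType) (V : zmodType)
    (h : {additive V -> R}) :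
  ~ limit_point (range h) (0 : R) ->
  exists2 e : R, 0 < e & forall x, h x != 0 -> e <= `|h x|.
Proof.
move=> nlim; apply: contra_notP nlim => nbound U /nbhs_ballP[e /= e0 eU].
apply: contrapT => nU; apply: nbound; exists e => // x hx0.
rewrite leNgt; apply/negP => hxe; apply: nU; exists (h x); split => //.
  by exists x.
by apply: eU; rewrite -ball_normE /= sub0r normrN.
Qed.

(** A generator is a least positive value of [h]. Such a value exists because two
values with the same integer quotient by the gap [e] are less than [e] apart,
hence equal: a positive value with least quotient is the least one, and the
Euclidean remainder of any other value by it has to vanish. *)
Lemma discrete_image_cyclic (R : realType) (V : zmodType)
    (h : {additive V -> R}) :
  ~ limit_point (range h) (0 : R) ->
  exists g : R, forall x, exists z : int, h x = g *~ z.
Proof.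
move=> /nonzero_image_bounded_below[e e0 gap].
have [[x0 hx0]|h0] := pselect (exists x, 0 < h x); last first.
  exists 0 => x; exists 0; rewrite mulr0z.
  case: (ltgtP (h x) 0) => // hx; case: h0; last by exists x.
  by exists (- x); rewrite raddfN oppr_gt0.
pose P n := `[< exists2 x, 0 < h x & Num.truncn (h x / e) = n >].
have exP : exists n, P n.
  by exists (Num.truncn (h x0 / e)); apply/asboolP; exists x0.
case: (ex_minnP exP) => n /asboolP[x hx hxn] nmin.
exists (h x) => y; set z := Num.floor (h y / h x); exists z.
have /andP[z_le z_gt] := floor_itv (h y / h x).
have hr : h (y - x *~ z) = h y - h x * z%:~R by rewrite raddfB raddfMz mulrzr.
rewrite ler_pdivlMr // -/z in z_le.
rewrite ltr_pdivrMr // -/z intrD mulrDl mul1r in z_gt.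
suff r0 : h (y - x *~ z) = 0.
  by apply/eqP; rewrite -subr_eq0 -mulrzr -hr r0.
have r_ge0 : 0 <= h (y - x *~ z) by rewrite hr; lra.
have r_lt : h (y - x *~ z) < h x by rewrite hr; lra.
apply/eqP/negPn/negP => r_neq0.
have r_gt0 : 0 < h (y - x *~ z) by rewrite lt0r r_neq0.
(* The quotient is at most that of [h x] as the remainder is smaller, and at
   least that by minimality. *)
have rn : Num.truncn (h (y - x *~ z) / e) = n.
  apply/eqP; rewrite eqn_leq; apply/andP; split.
    by rewrite -hxn le_truncn // ler_pM2r ?invr_gt0 // ltW.
  by apply: nmin; apply/asboolP; exists (y - x *~ z).
have := @truncn_itv _ (h x / e) (ltW (divr_gt0 hx e0)).
have := @truncn_itv _ (h (y - x *~ z) / e) (ltW (divr_gt0 r_gt0 e0)).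
rewrite rn hxn !ler_pdivlMr // !ltr_pdivrMr // -natr1.
move=> /andP[r1 _] /andP[_ x2].
have d_gt0 : 0 < h (x - (y - x *~ z)) by rewrite raddfB subr_gt0.
have := gap _ (lt0r_neq0 d_gt0).
by rewrite gtr0_norm // raddfB; lra.
Qed.

Lemma lift0_ord2 : lift ord0 ord0 = 1 :> 'I_2.
Proof. exact/val_inj. Qed.

Lemma det2 (R : comNzRingType) (M : 'M[R]_2) :
  \det M = M 0 0 * M 1 1 - M 0 1 * M 1 0.
Proof.
rewrite (expand_det_row _ 0) !big_ord_recl big_ord0 /cofactor !det_mx11 !mxE /=.
have -> : lift (lift ord0 ord0) 0 = 0 :> 'I_2 by exact/val_inj.
rewrite -[lift 0 0]/(lift ord0 ord0) !lift0_ord2 expr0 expr1; ring.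
Qed.

(** Writing [N = L *m D *m Q] in Smith form, [M = Q^-1 *m S *m L^-1] has
[\tr (N *m M) = \tr (D *m S)], which is [0] for any [S] with zero diagonal,
while the off-diagonal entries of [S] are free to fix the determinant. *)
Lemma exists_traceless_product (N : 'M[int]_2) :
  exists2 M : 'M[int]_2, \det M = -1 & \tr (N *m M) = 0.
Proof.
have [L Lu [Q Qu [d _ ->]]] := int_Smith_normal_form N.
set D := \matrix_(i, j) _; pose e := \det L * \det Q.
(* The entry [e] makes [\det S = - e], which compensates the unknown signs
   of [\det L] and [\det Q]. *)
pose S : 'M[int]_2 := \matrix_(i, j)
  (if i == j then 0 else if i == 0 then 1 else e).
exists (invmx Q *m S *m invmx L).
  have detS : \det S = - e.
    by rewrite det2 !mxE /= mul0r sub0r mul1r.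
  rewrite !det_mulmx !det_inv detS mulrN mulNr /e [\det L * _]mulrC.
  by rewrite mulKr -?unitmxE // mulrV -?unitmxE.
rewrite -!mulmxA (mulmxA Q) mulmxV // mul1mx mxtrace_mulC -!mulmxA mulVmx //.
rewrite mulmx1 /mxtrace big1 // => i _; rewrite mxE big1 // => j _; rewrite !mxE.
by rewrite [j == i]eq_sym -val_eqE; case: eqP => _; rewrite ?mulr0 ?mul0r.
Qed.

Lemma exists_orthogonal_root (A B C D : int) :
  exists k l m n : int,
    lattice_roots ((k, l), (m, n)) /\ k * A + l * B + m * C + n * D = 0.
Proof.
(* [N] is read off from the trace of its product with the matrix of rows
   [(k, m)] and [(- n, l)]. *)
pose N : 'M[int]_2 := \matrix_(i, j)
  (if i == 0 then if j == 0 then A else - D else if j == 0 then C else B).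
have [M detM trM] := exists_traceless_product N.
exists (M 0 0), (M 1 1), (M 0 1), (- M 1 0).
split.
  rewrite /lattice_roots /= form22_sqr.
  move: detM; rewrite det2 => detM.
  by transitivity (- 2 * \det M); rewrite det2; [ring|rewrite detM].
move: trM; rewrite /mxtrace !big_ord_recl big_ord0 !mxE !big_ord_recl !big_ord0.
rewrite !mxE /= !lift0_ord2 => <-; ring.
Qed.

Lemma pair_mulrz (U V : zmodType) (x : U) (y : V) (n : int) :
  (x, y) *~ n = (x *~ n, y *~ n).
Proof.
by rewrite [LHS]surjective_pairing (raddfMz fst) (raddfMz snd).
Qed.

Lemma additive_coords (R : realType) (h : {additive Gamma22 -> R})
    (k l m n : int) :
  h ((k, l), (m, n)) = h ((1, 0), (0, 0)) *~ k + h ((0, 1), (0, 0)) *~ l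
    + h ((0, 0), (1, 0)) *~ m + h ((0, 0), (0, 1)) *~ n.
Proof.
rewrite -!raddfMz -!raddfD; congr (h _); rewrite !pair_mulrz.
by rewrite !intz !mul0rz; congr ((_, _), (_, _)) => /=; rewrite ?addr0 ?add0r.
Qed.

Theorem proposition2 (R : realType) (h : {additive Gamma22 -> R})
    (h_neq0 : forall a : Gamma22, lattice_roots a -> h a <> 0) :
  limit_point (range h) (0 : R).
Proof.
apply: contrapT => /discrete_image_cyclic[g gen].
have [A hA] := gen ((1, 0), (0, 0)); have [B hB] := gen ((0, 1), (0, 0)).
have [C hC] := gen ((0, 0), (1, 0)); have [D hD] := gen ((0, 0), (0, 1)).
have [k [l [m [n [root orth]]]]] := exists_orthogonal_root A B C D.
apply: (h_neq0 _ root); rewrite additive_coords hA hB hC hD -!mulrzA.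
by rewrite -!mulrzDr [A * k]mulrC [B * l]mulrC [C * m]mulrC [D * n]mulrC orth.
Qed.
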